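(* Let $(M,A,f)$ be a Hom-associative algebra in $\mathcal{LM}$ and let $(V,W,\varphi)$ be a bimodule of $(M,A,f)$. There is a one-to-one correspondence between equivalence classes of abelian extensions of $(M,A,f)$ by $(V,W,\varphi)$ (inducing the given bimodule structure on $(V,W,\varphi)$) and the elements of the second cohomology group $\mathbf{H}^2((M,A,f),(V,W,\varphi))$.
   Context: All vector spaces are over a fixed field of characteristic $0$. A Hom-associative algebra $(A,\alpha)$ is a vector space $A$ with a bilinear multiplication and a linear map $\alpha:A\to A$ with $\alpha(x)(yz)=(xy)\alpha(z)$; Hom-associative algebras are always assumed multiplicative: $\alpha(xy)=\alpha(x)\alpha(y)$. A bimodule of $(A,\alpha)$ is a vector space $M$ with a linear map $\alpha_M:M\to M$ and bilinear left and right actions $x\cdot m$, $m\cdot x\in M$ such that for all $x,y\in A$, $m\in M$: $\alpha_M(x\cdot m)=\alpha(x)\cdot\alpha_M(m)$, $\alpha_M(m\cdot x)=\alpha_M(m)\cdot\alpha(x)$, $\alpha(x)\cdot(y\cdot m)=(xy)\cdot\alpha_M(m)$, $\alpha_M(m)\cdot(xy)=(m\cdot x)\cdot\alpha(y)$, $\alpha(x)\cdot(m\cdot y)=(x\cdot m)\cdot\alpha(y)$. A Hom-associative algebra $(M,A,f)$ in $\mathcal{LM}$ (the Loday-Pirashvili category of linear maps) consists of a Hom-associative algebra $(A,\alpha)$, a bimodule $(M,\alpha_M)$ of it, and a linear map $f:M\to A$ with $\alpha\circ f=f\circ\alpha_M$, $f(x\cdot m)=xf(m)$, $f(m\cdot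 x)=f(m)x$. A morphism $(M,A,f)\to(M',A',f')$ is a pair of linear maps $\phi_0:A\to A'$, $\phi_1:M\to M'$ commuting with the Hom-maps such that $\phi_0(xy)=\phi_0(x)\phi_0(y)$, $\phi_1(x\cdot m)=\phi_0(x)\cdot\phi_1(m)$, $\phi_1(m\cdot x)=\phi_1(m)\cdot\phi_0(x)$, $f'\circ\phi_1=\phi_0\circ f$. A bimodule $(V,W,\varphi)$ of $(M,A,f)$ consists of: bimodules $(V,\alpha_V)$ and $(W,\alpha_W)$ of $(A,\alpha)$; a bimodule map $\varphi:(V,\alpha_V)\to(W,\alpha_W)$, i.e. a linear map with $\varphi\circ\alpha_V=\alpha_W\circ\varphi$, $\varphi(x\cdot v)=x\cdot\varphi(v)$, $\varphi(v\cdot x)=\varphi(v)\cdot x$; and linear maps $\triangleright:W\otimes M\to V$, $\triangleleft:M\otimes W\to V$ such that for all $x\in A$, $m\in M$, $w\in W$: $\varphi(w\triangleright m)=w\cdot f(m)$, $\varphi(m\triangleleft w)=f(m)\cdot w$, $\alpha(x)\cdot(w\triangleright m)=(x\cdot w)\triangleright\alpha_M(m)$, $\alpha_W(w)\triangleright(x\cdot m)=(w\cdot x)\triangleright\alpha_M(m)$, $(m\triangleleft w)\cdot\alpha(x)=\alpha_M(m)\triangleleft(w\cdot x)$, $(m\cdot x)\triangleleft\alpha_W(w)=\alpha_M(m)\triangleleft(x\cdot w)$, $\alpha(x)\cdot(m\triangleleft w)=(x\cdot m)\triangleleft\alpha_W(w)$, $\alpha_W(w)\triangleright(m\cdot x)=(w\triangleright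 m)\cdot\alpha(x)$. Abelian extensions. Regard $(V,W,\varphi)$ as an abelian Hom-associative algebra in $\mathcal{LM}$ (zero multiplication on $W$, zero left and right actions of $W$ on $V$). An abelian extension of $(M,A,f)$ by $(V,W,\varphi)$ is a Hom-associative algebra $(\widehat M,\widehat A,\widehat f)$ in $\mathcal{LM}$ with morphisms $i=(i_0,i_1):(V,W,\varphi)\to(\widehat M,\widehat A,\widehat f)$ and $p=(p_0,p_1):(\widehat M,\widehat A,\widehat f)\to(M,A,f)$ such that $0\to V\xrightarrow{i_1}\widehat M\xrightarrow{p_1}M\to0$ and $0\to W\xrightarrow{i_0}\widehat A\xrightarrow{p_0}A\to0$ are exact. $V,W$ are identified with their images. The bimodule structure it induces on $(V,W,\varphi)$ is $x\cdot v=\hat x\cdot v$, $v\cdot x=v\cdot\hat x$, $x\cdot w=\hat xw$, $w\cdot x=w\hat x$, $w\triangleright m=w\cdot\hat m$, $m\triangleleft w=\hat m\cdot w$, where $\hat x\in\widehat A$ and $\hat m\in\widehat M$ are lifts of $x\in A$, $m\in M$, i.e. $p_0(\hat x)=x$, $p_1(\hat m)=m$ (the result does not depend on the lifts). Two extensions (with maps $i,p$ and $j,q$) are equivalent if there is a morphism $F$ from the first to the second with $F\circ i=j$ and $q\circ F=p$. Cohomology. $\mathbf{H}^2((M,A,f),(V,W,\varphi))=Z^2/B^2$. $Z^2$ (the $2$-cocycles) is the space of quadruples of linear maps $(\omega,\mu,\nu,\theta)$, $\omega:A\otimes A\to W$, $\mu:A\otimes M\to V$, $\nu:M\otimes A\to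 V$, $\theta:M\to W$, such that for all $x,y,z\in A$, $m\in M$: (1) $\theta(x\cdot m)+\varphi(\mu(x,m))-x\cdot\theta(m)-\omega(x,f(m))=0$; (2) $\theta(m\cdot x)+\varphi(\nu(m,x))-\omega(f(m),x)-\theta(m)\cdot x=0$; (3) $\alpha(x)\cdot\omega(y,z)+\omega(\alpha(x),yz)-\omega(xy,\alpha(z))-\omega(x,y)\cdot\alpha(z)=0$; (4) $\alpha(x)\cdot\mu(y,m)+\mu(\alpha(x),y\cdot m)-\omega(x,y)\triangleright\alpha_M(m)-\mu(xy,\alpha_M(m))=0$; (5) $\alpha_M(m)\triangleleft\omega(x,y)+\nu(\alpha_M(m),xy)-\nu(m,x)\cdot\alpha(y)-\nu(m\cdot x,\alpha(y))=0$; (6) $\alpha(x)\cdot\nu(m,y)+\mu(\alpha(x),m\cdot y)-\nu(x\cdot m,\alpha(y))-\mu(x,m)\cdot\alpha(y)=0$. $B^2\subseteq Z^2$ (the $2$-coboundaries) is the space of quadruples given by $\omega(x,y)=N_0(x)\cdot y+x\cdot N_0(y)-N_0(xy)$, $\mu(x,m)=N_0(x)\triangleright m+x\cdot N_1(m)-N_1(x\cdot m)$, $\nu(m,x)=N_1(m)\cdot x+m\triangleleft N_0(x)-N_1(m\cdot x)$, $\theta(m)=\varphi(N_1(m))-N_0(f(m))$, for linear maps $N_0:A\to W$, $N_1:M\to V$ with $N_0\alpha=\alpha_WN_0$, $N_1\alpha_M=\alpha_VN_1$.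
   Formalization: Added, as the claim fails otherwise: bimodules satisfy α_V(w▷m)=α_W(w)▷α_M(m) and α_V(m◁w)=α_M(m)◁α_W(w); 2-cocycles commute with the Hom-maps; the exact sequences of an abelian extension have linear sections commuting with the Hom-maps. *)

(* Defs.v *)
From HB Require Import structures.
From mathcomp Require Import all_boot all_algebra ring_quotient.
From mathcomp Require Import boolp functions.

Set Implicit Arguments.
Unset Strict Implicit.
Unset Printing Implicit Defensive.

Import GRing.Theory.
Local Open Scope ring_scope.

Declare Scope hom_scope.
Delimit Scope hom_scope with hom.
Reserved Notation "x ∙ y" (at level 40, left associativity).
Reserved Notation "x ∙> m" (at level 40, left associativity).
Reserved Notation "m <∙ x" (at level 40, left associativity).
Reserved Notation "w ▷ m" (at level 40, left associativity).
Reserved Notation "m ◁ w" (at level 40, left associativity).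

Record homAssoc (K : fieldType) := HomAssoc {
  ha_car :> lmodType K;
  ha_mul : {bilinear ha_car -> ha_car -> ha_car};
  alpha : {linear ha_car -> ha_car};
  ha_assoc : forall x y z,
    ha_mul (alpha x) (ha_mul y z) = ha_mul (ha_mul x y) (alpha z);
  alphaM : forall x y, alpha (ha_mul x y) = ha_mul (alpha x) (alpha y) }.

Notation "x ∙ y" := (ha_mul _ x y) : hom_scope.
Open Scope hom_scope.

Record homBimod (K : fieldType) (A : homAssoc K) := HomBimod {
  hb_car :> lmodType K;
  lact : {bilinear A -> hb_car -> hb_car};
  ract : {bilinear hb_car -> A -> hb_car};
  beta : {linear hb_car -> hb_car};
  beta_lact : forall x m, beta (lact x m) = lact (alpha A x) (beta m);
  beta_ract : forall m x, beta (ract m x) = ract (beta m) (alpha A x);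
  lact_assoc : forall x y m,
    lact (alpha A x) (lact y m) = lact (x ∙ y) (beta m);
  ract_assoc : forall m x y,
    ract (beta m) (x ∙ y) = ract (ract m x) (alpha A y);
  lract_assoc : forall x m y,
    lact (alpha A x) (ract m y) = ract (lact x m) (alpha A y) }.

Notation "x ∙> m" := (lact _ x m) : hom_scope.
Notation "m <∙ x" := (ract _ m x) : hom_scope.

(* [HomLM lm0 lm1 lmf] is the triple (M, A, f) with A = lm0 and M = lm1. *)
Record homLM (K : fieldType) := HomLM {
  lm0 : homAssoc K;
  lm1 : homBimod lm0;
  lmf : {linear lm1 -> lm0};
  lmf_alpha : forall m, alpha lm0 (lmf m) = lmf (beta lm1 m);
  lmf_lact : forall x m, lmf (x ∙> m) = x ∙ lmf m;
  lmf_ract : forall m x, lmf (m <∙ x) = lmf m ∙ x }.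

Record homLM_mor (K : fieldType) (X Y : homLM K) := HomLMMor {
  mor0 : {linear lm0 X -> lm0 Y};
  mor1 : {linear lm1 X -> lm1 Y};
  mor0_alpha : forall x, mor0 (alpha (lm0 X) x) = alpha (lm0 Y) (mor0 x);
  mor1_beta : forall m, mor1 (beta (lm1 X) m) = beta (lm1 Y) (mor1 m);
  mor0_mul : forall x y, mor0 (x ∙ y) = mor0 x ∙ mor0 y;
  mor1_lact : forall x m, mor1 (x ∙> m) = mor0 x ∙> mor1 m;
  mor1_ract : forall m x, mor1 (m <∙ x) = mor1 m <∙ mor0 x;
  mor_f : forall m, lmf Y (mor1 m) = mor0 (lmf X m) }.

(* [rtri_beta] and [ltri_beta] say that ▷ and ◁ are maps of Hom-modules.  They
   hold for every bimodule induced by an extension, because the Hom-map of the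
   middle term is multiplicative; without them the split null extension is not
   a (multiplicative) object of LM. *)
Record homLM_bimod (K : fieldType) (X : homLM K) := HomLMBimod {
  bV : homBimod (lm0 X);
  bW : homBimod (lm0 X);
  phi : {linear bV -> bW};
  phi_beta : forall v, phi (beta bV v) = beta bW (phi v);
  phi_lact : forall x v, phi (x ∙> v) = x ∙> phi v;
  phi_ract : forall v x, phi (v <∙ x) = phi v <∙ x;
  rtri : {bilinear bW -> lm1 X -> bV};
  ltri : {bilinear lm1 X -> bW -> bV};
  rtri_beta : forall w m,
    beta bV (rtri w m) = rtri (beta bW w) (beta (lm1 X) m);
  ltri_beta : forall m w,
    beta bV (ltri m w) = ltri (beta (lm1 X) m) (beta bW w);
  phi_rtri : forall w m, phi (rtri w m) = w <∙ lmf X m;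
  phi_ltri : forall m w, phi (ltri m w) = lmf X m ∙> w;
  lact_rtri : forall x w m,
    alpha (lm0 X) x ∙> rtri w m = rtri (x ∙> w) (beta (lm1 X) m);
  rtri_lact : forall w x m,
    rtri (beta bW w) (x ∙> m) = rtri (w <∙ x) (beta (lm1 X) m);
  ltri_ract : forall m w x,
    ltri m w <∙ alpha (lm0 X) x = ltri (beta (lm1 X) m) (w <∙ x);
  ract_ltri : forall m x w,
    ltri (m <∙ x) (beta bW w) = ltri (beta (lm1 X) m) (x ∙> w);
  lact_ltri : forall x m w,
    alpha (lm0 X) x ∙> ltri m w = ltri (x ∙> m) (beta bW w);
  rtri_ract : forall w m x,
    rtri (beta bW w) (m <∙ x) = rtri w m <∙ alpha (lm0 X) x }.

Notation "w ▷ m" := (rtri _ w m) : hom_scope.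
Notation "m ◁ w" := (ltri _ m w) : hom_scope.

Section ZeroBilinear.
Variables (K : fieldType) (U V W : lmodType K).

Definition zero2 (_ : U) (_ : V) : W := 0.

Fact zero2_bilinear : bilinear_for *:%R *:%R zero2.
Proof. by split=> u a v w; rewrite /zero2 /= scaler0 addr0. Qed.

HB.instance Definition _ :=
  bilinear_isBilinear.Build K U V W *:%R *:%R zero2 zero2_bilinear.

End ZeroBilinear.

Section AbelianLM.
Variables (K : fieldType) (X : homLM K) (B : homLM_bimod X).

Let zmul (U V W : lmodType K) : {bilinear U -> V -> W} := @zero2 K U V W.

Fact abelian_alg_assoc (x y z : bW B) :
  zmul _ _ (bW B) (beta _ x) (zmul _ _ (bW B) y z)
    = zmul _ _ (bW B) (zmul _ _ (bW B) x y) (beta _ z).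
Proof. by []. Qed.

Fact abelian_algM (x y : bW B) :
  beta _ (zmul _ _ (bW B) x y) = zmul _ _ (bW B) (beta _ x) (beta _ y).
Proof. exact: linear0. Qed.

Definition abelian_alg : homAssoc K :=
  @HomAssoc K (bW B) (zmul _ _ _) (beta (bW B)) abelian_alg_assoc abelian_algM.

Definition abelian_mod : homBimod abelian_alg.
Proof.
refine (@HomBimod K abelian_alg (bV B) (zmul _ _ _) (zmul _ _ _)
  (beta (bV B)) _ _ _ _ _); by move=> * //; exact: linear0.
Defined.

Definition abelian_LM : homLM K.
Proof.
refine (@HomLM K abelian_alg abelian_mod (phi B) _ _ _).
- by move=> v; rewrite /= phi_beta.
- by move=> *; exact: linear0.
- by move=> *; exact: linear0.
Defined.

End AbelianLM.

Section Extension.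
Variables (K : fieldType) (X : homLM K) (B : homLM_bimod X).

Definition exact_seq (U V W : lmodType K) (i : U -> V) (p : V -> W) :=
  [/\ injective i, forall v, p v = 0 <-> exists u, i u = v
    & forall w, exists v, p v = w].

Definition hom_section (E : homLM K) (p : homLM_mor E X)
    (s0 : {linear lm0 X -> lm0 E}) (s1 : {linear lm1 X -> lm1 E}) :=
  [/\ forall x, mor0 p (s0 x) = x,
      forall m, mor1 p (s1 m) = m,
      forall x, s0 (alpha (lm0 X) x) = alpha (lm0 E) (s0 x)
    & forall m, s1 (beta (lm1 X) m) = beta (lm1 E) (s1 m)].

(* The exact sequences are required to split as sequences of Hom-modules
   ([ext_split]); compatibility of the sections with the products, the actions
   or f is not required.  Non-split Hom-maps on the middle term are not seen
   by H^2: for A = W = 0 and M = V = K with zero Hom-maps, H^2 vanishes, while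
   the Hom-maps (m, v) |-> (0, c m) on M + V, c in K, are pairwise
   inequivalent. *)
Record abelian_ext := AbelianExt {
  ext : homLM K;
  ext_i : homLM_mor (abelian_LM B) ext;
  ext_p : homLM_mor ext X;
  ext_exact0 : exact_seq (mor0 ext_i) (mor0 ext_p);
  ext_exact1 : exact_seq (mor1 ext_i) (mor1 ext_p);
  ext_split : exists s0 s1, hom_section ext_p s0 s1;
  ext_lactV : forall (x : lm0 X) (xh : lm0 ext) (v : bV B),
    mor0 ext_p xh = x -> mor1 ext_i (x ∙> v) = xh ∙> mor1 ext_i v;
  ext_ractV : forall (x : lm0 X) (xh : lm0 ext) (v : bV B),
    mor0 ext_p xh = x -> mor1 ext_i (v <∙ x) = mor1 ext_i v <∙ xh;
  ext_lactW : forall (x : lm0 X) (xh : lm0 ext) (w : bW B),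
    mor0 ext_p xh = x -> mor0 ext_i (x ∙> w) = xh ∙ mor0 ext_i w;
  ext_ractW : forall (x : lm0 X) (xh : lm0 ext) (w : bW B),
    mor0 ext_p xh = x -> mor0 ext_i (w <∙ x) = mor0 ext_i w ∙ xh;
  ext_rtri : forall (m : lm1 X) (mh : lm1 ext) (w : bW B),
    mor1 ext_p mh = m -> mor1 ext_i (w ▷ m) = mor0 ext_i w ∙> mh;
  ext_ltri : forall (m : lm1 X) (mh : lm1 ext) (w : bW B),
    mor1 ext_p mh = m -> mor1 ext_i (m ◁ w) = mh <∙ mor0 ext_i w }.

Definition ext_equiv (E E' : abelian_ext) :=
  exists F : homLM_mor (ext E) (ext E'),
    [/\ forall w, mor0 F (mor0 (ext_i E) w) = mor0 (ext_i E') w,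
        forall v, mor1 F (mor1 (ext_i E) v) = mor1 (ext_i E') v,
        forall x, mor0 (ext_p E') (mor0 F x) = mor0 (ext_p E) x
      & forall m, mor1 (ext_p E') (mor1 F m) = mor1 (ext_p E) m].

End Extension.

Section Cohomology.
Variables (K : fieldType) (X : homLM K) (B : homLM_bimod X).

Local Notation A := (lm0 X).
Local Notation M := (lm1 X).
Local Notation f := (lmf X).
Local Notation al := (alpha A).
Local Notation alM := (beta M).
Local Notation V := (bV B).
Local Notation W := (bW B).
Local Notation alV := (beta V).
Local Notation alW := (beta W).

(* Quadruples of arbitrary functions, as an ambient K-module. *)
Definition quad : lmodType K :=
  ((A -> A -> W) * (A -> M -> V) * (M -> A -> V) * (M -> W))%type.

Definition omega (c : quad) : A -> A -> W := c.1.1.1.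
Definition mu (c : quad) : A -> M -> V := c.1.1.2.
Definition nu (c : quad) : M -> A -> V := c.1.2.
Definition theta (c : quad) : M -> W := c.2.

Definition bilin (U1 U2 U3 : lmodType K) (g : U1 -> U2 -> U3) :=
  (forall u, linear (g u)) /\ (forall u, linear (g^~ u)).

(* Cochains commute with the Hom-maps, as N_0 and N_1 do in the definition of
   coboundaries: this is the multiplicativity of the Hom-maps of the extension
   defined by the cochain. *)
Definition cochain (c : quad) : Prop :=
  [/\ [/\ bilin (omega c), bilin (mu c), bilin (nu c) & linear (theta c)],
      forall x y, alW (omega c x y) = omega c (al x) (al y),
      forall x m, alV (mu c x m) = mu c (al x) (alM m),
      forall m x, alV (nu c m x) = nu c (alM m) (al x)
    & forall m, alW (theta c m) = theta c (alM m)].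

Definition cocycle_eqs (c : quad) : Prop :=
  let: (om, mu, nu, th) := (omega c, mu c, nu c, theta c) in
  [/\ forall x m,
        th (x ∙> m) + phi B (mu x m) - x ∙> th m - om x (f m) = 0,
      forall m x,
        th (m <∙ x) + phi B (nu m x) - om (f m) x - th m <∙ x = 0,
      forall x y z,
        al x ∙> om y z + om (al x) (y ∙ z)
          - om (x ∙ y) (al z) - om x y <∙ al z = 0
    & [/\ forall x y m,
        al x ∙> mu y m + mu (al x) (y ∙> m)
          - om x y ▷ alM m - mu (x ∙ y) (alM m) = 0,
      forall m x y,
        alM m ◁ om x y + nu (alM m) (x ∙ y)
          - nu m x <∙ al y - nu (m <∙ x) (al y) = 0
    & forall x m y,
        al x ∙> nu m y + mu (al x) (m <∙ y)
          - nu (x ∙> m) (al y) - mu x m <∙ al y = 0]].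

Definition Z2_pred : {pred quad} := fun c => `[< cochain c /\ cocycle_eqs c >].

Fact lin4 (U : lmodType K) (a : K) (t1 t2 t3 t4 u1 u2 u3 u4 : U) :
  t1 + t2 - t3 - t4 = 0 -> u1 + u2 - u3 - u4 = 0 ->
  (a *: t1 + u1) + (a *: t2 + u2) - (a *: t3 + u3) - (a *: t4 + u4) = 0.
Proof.
move=> ht hu; transitivity (a *: (t1 + t2 - t3 - t4) + (u1 + u2 - u3 - u4)).
  rewrite !scalerDr !scalerN [RHS]addrACA -opprD; congr (_ - _).
  by rewrite [RHS]addrACA -opprD; congr (_ - _); rewrite addrACA.
by rewrite ht hu scaler0 addr0.
Qed.

Fact linear_comb (U1 U2 : lmodType K) (a : K) (g h : U1 -> U2) :
  linear g -> linear h -> linear (fun x => a *: g x + h x).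
Proof.
move=> gl hl b v w; rewrite /= gl hl /= !scalerDr !scalerA mulrC.
by rewrite addrACA.
Qed.

Fact bilin_comb (U1 U2 U3 : lmodType K) (a : K) (g h : U1 -> U2 -> U3) :
  bilin g -> bilin h -> bilin (fun x y => a *: g x y + h x y).
Proof.
move=> [g1 g2] [h1 h2]; split=> u; first exact: linear_comb.
exact: linear_comb (g2 u) (h2 u).
Qed.

Fact bilin0 (U1 U2 U3 : lmodType K) : bilin (fun (_ : U1) (_ : U2) => 0 : U3).
Proof. by split=> u b v w; rewrite scaler0 addr0. Qed.

Fact lin40 (U : lmodType K) (t1 t2 t3 t4 : U) :
  t1 = 0 -> t2 = 0 -> t3 = 0 -> t4 = 0 -> t1 + t2 - t3 - t4 = 0.
Proof. by move=> -> -> -> ->; rewrite !subr0 addr0. Qed.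

Fact fst_comb (U1 U2 : lmodType K) (a : K) (c d : (U1 * U2)%type) :
  (a *: c + d).1 = a *: c.1 + d.1.
Proof. by []. Qed.

Fact snd_comb (U1 U2 : lmodType K) (a : K) (c d : (U1 * U2)%type) :
  (a *: c + d).2 = a *: c.2 + d.2.
Proof. by []. Qed.

Fact quad0 : [/\ omega 0 = (fun _ _ => 0), mu 0 = (fun _ _ => 0),
  nu 0 = (fun _ _ => 0) & theta 0 = (fun _ => 0)].
Proof. by []. Qed.

Fact quad_comb (a : K) (c d : quad) :
  [/\ omega (a *: c + d) = (fun x y => a *: omega c x y + omega d x y),
      mu (a *: c + d) = (fun x m => a *: mu c x m + mu d x m),
      nu (a *: c + d) = (fun m x => a *: nu c m x + nu d m x)
    & theta (a *: c + d) = (fun m => a *: theta c m + theta d m)].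
Proof. by rewrite /omega /mu /nu /theta !fst_comb !snd_comb. Qed.

Fact Z2_submod_closed : submod_closed Z2_pred.
Proof.
split.
  apply/asboolP; rewrite /cochain /cocycle_eqs; have [-> -> -> ->] := quad0.
  split.
    split=> [|x y|x m|m x|m]; rewrite ?linear0 //.
    by split; [exact: bilin0..|move=> b u v; rewrite scaler0 addr0].
  split=> [x m|m x|x y z|]; [| | |split=> [x y m|m x y|x m y]];
  by apply: lin40; rewrite // ?linear0 ?linear0l.
move=> a c d /asboolP[[[c1 c2 c3 c4] c5 c6 c7 c8] [e1 e2 e3 [e4 e5 e6]]].
move=> /asboolP[[[d1 d2 d3 d4] d5 d6 d7 d8] [g1 g2 g3 [g4 g5 g6]]].
apply/asboolP; rewrite /cochain /cocycle_eqs.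
have [-> -> -> ->] := quad_comb a c d; split.
  split=> [|x y|x m|m x|m]; rewrite ?linearP /=.
  - by split; [exact: bilin_comb..|exact: linear_comb].
  - by rewrite c5 d5.
  - by rewrite c6 d6.
  - by rewrite c7 d7.
  - by rewrite c8 d8.
split=> [x m|m x|x y z|]; [| | |split=> [x y m|m x y|x m y]].
- apply: etrans (lin4 a (e1 x m) (g1 x m)).
  by congr (_ + _ - _ - _); rewrite ?linearP ?linearPl.
- apply: etrans (lin4 a (e2 m x) (g2 m x)).
  by congr (_ + _ - _ - _); rewrite ?linearP ?linearPl.
- apply: etrans (lin4 a (e3 x y z) (g3 x y z)).
  by congr (_ + _ - _ - _); rewrite ?linearP ?linearPl.
- apply: etrans (lin4 a (e4 x y m) (g4 x y m)).
  by congr (_ + _ - _ - _); rewrite ?linearP ?linearPl.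
- apply: etrans (lin4 a (e5 m x y) (g5 m x y)).
  by congr (_ + _ - _ - _); rewrite ?linearP ?linearPl.
- apply: etrans (lin4 a (e6 x m y) (g6 x m y)).
  by congr (_ + _ - _ - _); rewrite ?linearP ?linearPl.
Qed.

HB.instance Definition _ :=
  GRing.isSubmodClosed.Build K quad Z2_pred
    (GRing.submod_closed_semi Z2_submod_closed).

Record Z2 := Cocycle2 { z2val :> quad; z2valP : z2val \in Z2_pred }.

HB.instance Definition _ := [isSub for z2val].
HB.instance Definition _ := [Choice of Z2 by <:].
HB.instance Definition _ := [SubChoice_isSubLmodule of Z2 by <:].

Definition coboundary (c : quad) : Prop :=
  exists (N0 : {linear A -> W}) (N1 : {linear M -> V}),
    [/\ forall x, N0 (al x) = alW (N0 x),
        forall m, N1 (alM m) = alV (N1 m)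
      & [/\ forall x y, omega c x y = N0 x <∙ y + x ∙> N0 y - N0 (x ∙ y),
            forall x m, mu c x m = N0 x ▷ m + x ∙> N1 m - N1 (x ∙> m),
            forall m x, nu c m x = N1 m <∙ x + m ◁ N0 x - N1 (m <∙ x)
          & forall m, theta c m = phi B (N1 m) - N0 (f m)]].

Definition B2_pred : {pred Z2} := fun c => `[< coboundary c >].

Fact z2val_comb (a : K) (c d : Z2) : z2val (a *: c + d) = a *: z2val c + z2val d.
Proof. exact: (linearP (val : {linear Z2 -> quad})). Qed.

Fact z2valB (c d : Z2) : z2val (c - d) = z2val c - z2val d.
Proof. exact: (raddfB (val : {linear Z2 -> quad})). Qed.

Fact comb4 (U : lmodType K) (a : K) (t1 t2 t3 u1 u2 u3 : U) :
  a *: (t1 + t2 - t3) + (u1 + u2 - u3)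
    = (a *: t1 + u1) + (a *: t2 + u2) - (a *: t3 + u3).
Proof.
by rewrite !scalerDr scalerN addrACA -opprD; congr (_ - _); rewrite addrACA.
Qed.

Fact comb3 (U : lmodType K) (a : K) (t1 t2 u1 u2 : U) :
  a *: (t1 - t2) + (u1 - u2) = (a *: t1 + u1) - (a *: t2 + u2).
Proof. by rewrite scalerDr scalerN addrACA -opprD. Qed.

Fact coboundary_comb (a : K) (c d : quad) :
  coboundary c -> coboundary d -> coboundary (a *: c + d).
Proof.
move=> [N0 [N1 [h0 h1 [c1 c2 c3 c4]]]] [P0 [P1 [k0 k1 [d1 d2 d3 d4]]]].
exists ((a \*: N0 \+ P0) : {linear A -> W}).
exists ((a \*: N1 \+ P1) : {linear M -> V}).
have [-> -> -> ->] := quad_comb a c d.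
split=> [x|m|] /=; first by rewrite linearP h0 k0.
  by rewrite linearP h1 k1.
split=> [x y|x m|m x|m] /=.
- by rewrite c1 d1 comb4; congr (_ + _ - _); rewrite ?linearP ?linearPl.
- by rewrite c2 d2 comb4; congr (_ + _ - _); rewrite ?linearP ?linearPl.
- by rewrite c3 d3 comb4; congr (_ + _ - _); rewrite ?linearP ?linearPl.
- by rewrite c4 d4 comb3; congr (_ - _); rewrite ?linearP.
Qed.

Fact coboundary0 : coboundary 0.
Proof.
exists (\0 : {linear A -> W}), (\0 : {linear M -> V}).
have [-> -> -> ->] := quad0.
split=> [x|m|] /=; rewrite ?linear0 //.
by split=> * /=; rewrite ?linear0 ?linear0l ?addr0 ?subr0.
Qed.

Fact B2_submod_closed : submod_closed B2_pred.
Proof.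
split; first by apply/asboolP; exact: coboundary0.
move=> a c d /asboolP hc /asboolP hd; apply/asboolP.
by rewrite z2val_comb; exact: coboundary_comb.
Qed.

HB.instance Definition _ :=
  GRing.isSubmodClosed.Build K Z2 B2_pred
    (GRing.submod_closed_semi B2_submod_closed).

Definition H2 := Quotient.quot B2_pred.
HB.instance Definition _ := GRing.Zmodule.on H2.

Definition H2_class (c : Z2) : H2 :=
  (\pi_(Quotient.quot B2_pred) c)%qT.

(* The cocycle of an extension relative to a pair of Hom-sections. *)
Definition section_cocycle (E : abelian_ext B)
    (s0 : {linear A -> lm0 (ext E)}) (s1 : {linear M -> lm1 (ext E)})
    (c : quad) : Prop :=
  [/\ forall x y, mor0 (ext_i E) (omega c x y) = s0 x ∙ s0 y - s0 (x ∙ y),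
      forall x m, mor1 (ext_i E) (mu c x m) = s0 x ∙> s1 m - s1 (x ∙> m),
      forall m x, mor1 (ext_i E) (nu c m x) = s1 m <∙ s0 x - s1 (m <∙ x)
    & forall m, mor0 (ext_i E) (theta c m) = lmf (ext E) (s1 m) - s0 (f m)].

End Cohomology.

(* Main.v *)
Require Import Defs.
From mathcomp Require Import all_boot all_algebra.
From HB Require Import structures.
From mathcomp Require Import ring_quotient boolp functions.

Set Implicit Arguments.
Unset Strict Implicit.
Unset Printing Implicit Defensive.

Import GRing.Theory.
Local Open Scope ring_scope.

(** A pair of Hom-linear sections (s0, s1) of an extension identifies the
    middle term with the direct sum of (M, A) and (V, W): every element of the
    middle term is s0 x + i w, respectively s1 m + i v.  Since W acts on V and
    multiplies itself by zero, the structure maps read in these coordinates are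
    those of the semidirect sum, corrected by the defect of s0 and s1 to be a
    morphism.  This defect is the quadruple (omega, mu, nu, theta), and it
    determines the extension with its sections up to isomorphism:

    - the axioms of the middle term translate, term by term, into the cocycle
      equations ([section_cocycle_cochain], [section_cocycle_eqs]);
    - two extensions with sections of equal defect have the same structure in
      coordinates, so matching the coordinates is an equivalence
      ([ext_equiv_same_cocycle]);
    - conversely a cocycle twists the structure on the direct sum, and the
      cocycle equations are what makes the twisted structure satisfy the axioms
      ([tw_ext], [tw_represents]).

    It remains to see what the choice of sections contributes.  Two sections of
    one extension differ by Hom-maps (N0, N1) into (W, V), and adding (N0, N1)
    to a section adds its coboundary to the cocycle ([hom_sections_differ],
    [section_cocycle_shift]).  An equivalence F carries sections to sections
    with the same cocycle, so the cocycles of equivalent extensions are cocycles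
    of two sections of the target; and if the cocycles c and c' differ by the
    coboundary of (N0, N1), the section for c' shifted by (N0, N1) has cocycle
    c.  Hence extensions are equivalent if and only if their cocycles are
    cohomologous ([ext_equivP]), and the class of the cocycle of any section is
    the required bijection. *)

(** * Linear algebra of split exact sequences *)

(** The shape of every cocycle equation once the defects of a section are
    expanded: four differences whose terms cancel in pairs around a square. *)
Lemma telescope_fork (U : zmodType) (a b c d : U) :
  (a - b) + (b - c) - (d - c) - (a - d) = 0.
Proof. by rewrite subrKA addrAC -addrA -opprD subrKA subrr. Qed.

Lemma linear_of_fun (K : fieldType) (U V : lmodType K) (g : U -> V) :
  linear g -> exists h : {linear U -> V}, h =1 g.
Proof.
move=> gl; pose l := GRing.isLinear.Build K U V *:%R g gl.
by exists (HB.pack g l : {linear U -> V}).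
Qed.

Lemma exact_lift (K : fieldType) (U V W T : lmodType K)
    (i : {linear U -> V}) (p : {linear V -> W}) (g : {linear T -> V}) :
  exact_seq i p -> (forall t, p (g t) = 0) ->
  exists h : {linear T -> U}, forall t, i (h t) = g t.
Proof.
move=> [inj_i ker_p _] pg0.
have /choice[h hE] t : exists u, i u = g t by apply/ker_p.
have [|h' h'E] := @linear_of_fun K _ _ h; last by exists h' => t; rewrite h'E hE.
by move=> a x y; apply: inj_i; rewrite hE !linearP !hE.
Qed.

(** A split extension is a direct sum, so linear maps out of it may be
    prescribed on the section and on the kernel separately. *)
Lemma split_extend (K : fieldType) (U V W T : lmodType K)
    (i : {linear U -> V}) (p : {linear V -> W}) (s : {linear W -> V})
    (j : {linear U -> T}) (t : {linear W -> T}) :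
  exact_seq i p -> (forall w, p (s w) = w) ->
  exists F : {linear V -> T}, forall w u, F (s w + i u) = t w + j u.
Proof.
move=> ip sK; have [inj_i ker_p _] := ip.
have pi u : p (i u) = 0 by apply/ker_p; exists u.
have [|r rE] := @exact_lift _ _ _ _ _ i p (idfun \- (s \o p)) ip.
  by move=> v; rewrite /= linearB /= sK subrr.
exists ((t \o p) \+ (j \o r)) => w u /=.
rewrite [p _]linearD sK pi addr0; congr (_ + j _); apply: inj_i.
by rewrite rE /= [p _]linearD sK pi addr0 addrC addKr.
Qed.

(** * An extension in the coordinates given by a section *)

Section ExtensionCoordinates.
Variables (K : fieldType) (X : homLM K) (B : homLM_bimod X) (E : abelian_ext B).

Local Notation A := (lm0 X).
Local Notation M := (lm1 X).
Local Notation V := (bV B).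
Local Notation W := (bW B).
Local Notation E0 := (lm0 (ext E)).
Local Notation E1 := (lm1 (ext E)).
Local Notation fE := (lmf (ext E)).

(** The structure maps of the extension, typed on the underlying spaces of V
    and W rather than on those of the abelian algebra they carry. *)
Definition inj0 : {linear W -> E0} := mor0 (ext_i E).
Definition inj1 : {linear V -> E1} := mor1 (ext_i E).
Definition proj0 : {linear E0 -> A} := mor0 (ext_p E).
Definition proj1 : {linear E1 -> M} := mor1 (ext_p E).

Lemma inj0_inj : injective inj0. Proof. by case: (ext_exact0 E). Qed.
Lemma inj1_inj : injective inj1. Proof. by case: (ext_exact1 E). Qed.

Lemma proj0_inj0 w : proj0 (inj0 w) = 0.
Proof. by case: (ext_exact0 E) => _ k _; apply/k; exists w. Qed.
Lemma proj1_inj1 v : proj1 (inj1 v) = 0.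
Proof. by case: (ext_exact1 E) => _ k _; apply/k; exists v. Qed.

Lemma inj0_alpha w : inj0 (beta W w) = alpha E0 (inj0 w).
Proof. exact: (mor0_alpha (ext_i E) w). Qed.
Lemma inj1_beta v : inj1 (beta V v) = beta E1 (inj1 v).
Proof. exact: (mor1_beta (ext_i E) v). Qed.
Lemma lmf_inj1 v : fE (inj1 v) = inj0 (phi B v).
Proof. exact: (mor_f (ext_i E) v). Qed.

Lemma inj0_mul0 w u : inj0 w ∙ inj0 u = 0.
Proof.
rewrite -[LHS](mor0_mul (ext_i E) (w : lm0 (abelian_LM B)) u).
exact: (linear0 inj0).
Qed.
Lemma inj_lact0 w v : inj0 w ∙> inj1 v = 0.
Proof.
rewrite -[LHS](mor1_lact (ext_i E) (w : lm0 (abelian_LM B)) v).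
exact: (linear0 inj1).
Qed.
Lemma inj_ract0 w v : inj1 v <∙ inj0 w = 0.
Proof.
rewrite -[LHS](mor1_ract (ext_i E) (v : lm1 (abelian_LM B)) w).
exact: (linear0 inj1).
Qed.

Section HomSection.
Variables (s0 : {linear A -> E0}) (s1 : {linear M -> E1}).
Hypothesis hs : hom_section (ext_p E) s0 s1.

Lemma proj0_sec x : proj0 (s0 x) = x. Proof. by case: hs. Qed.
Lemma proj1_sec m : proj1 (s1 m) = m. Proof. by case: hs. Qed.
Lemma sec0_alpha x : s0 (alpha A x) = alpha E0 (s0 x). Proof. by case: hs. Qed.
Lemma sec1_beta m : s1 (beta M m) = beta E1 (s1 m). Proof. by case: hs. Qed.

Lemma sec_mul_inj x w : s0 x ∙ inj0 w = inj0 (x ∙> w).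
Proof. by rewrite /inj0 (ext_lactW (xh := s0 x)) //; exact: proj0_sec. Qed.
Lemma inj_mul_sec w x : inj0 w ∙ s0 x = inj0 (w <∙ x).
Proof. by rewrite /inj0 (ext_ractW (xh := s0 x)) //; exact: proj0_sec. Qed.
Lemma sec_lact_inj x v : s0 x ∙> inj1 v = inj1 (x ∙> v).
Proof. by rewrite /inj1 (ext_lactV (xh := s0 x)) //; exact: proj0_sec. Qed.
Lemma inj_ract_sec v x : inj1 v <∙ s0 x = inj1 (v <∙ x).
Proof. by rewrite /inj1 (ext_ractV (xh := s0 x)) //; exact: proj0_sec. Qed.
Lemma inj_lact_sec w m : inj0 w ∙> s1 m = inj1 (w ▷ m).
Proof. by rewrite /inj1 (ext_rtri (mh := s1 m)) //; exact: proj1_sec. Qed.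
Lemma sec_ract_inj m w : s1 m <∙ inj0 w = inj1 (m ◁ w).
Proof. by rewrite /inj1 (ext_ltri (mh := s1 m)) //; exact: proj1_sec. Qed.

Lemma sec0_decomp e : exists x w, e = s0 x + inj0 w.
Proof.
have [_ k _] := ext_exact0 E.
have [] := (k (e - s0 (proj0 e))).1.
  by rewrite linearB -/proj0 proj0_sec subrr.
by move=> w wE; exists (proj0 e), w; rewrite [inj0 w]wE addrC subrK.
Qed.

Lemma sec1_decomp e : exists m v, e = s1 m + inj1 v.
Proof.
have [_ k _] := ext_exact1 E.
have [] := (k (e - s1 (proj1 e))).1.
  by rewrite linearB -/proj1 proj1_sec subrr.
by move=> v vE; exists (proj1 e), v; rewrite [inj1 v]vE addrC subrK.
Qed.

Section Coordinates.
Variable c : quad B.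
Hypothesis hc : section_cocycle s0 s1 c.

Lemma inj0_omega x y : inj0 (omega c x y) = s0 x ∙ s0 y - s0 (x ∙ y).
Proof. by case: hc. Qed.
Lemma inj1_mu x m : inj1 (mu c x m) = s0 x ∙> s1 m - s1 (x ∙> m).
Proof. by case: hc. Qed.
Lemma inj1_nu m x : inj1 (nu c m x) = s1 m <∙ s0 x - s1 (m <∙ x).
Proof. by case: hc. Qed.
Lemma inj0_theta m : inj0 (theta c m) = fE (s1 m) - s0 (lmf X m).
Proof. by case: hc. Qed.

(** In coordinates the product is that of the semidirect sum plus omega; the
    same holds below for the two actions and for f, with mu, nu and theta. *)
Lemma mul_coord x w y u :
  (s0 x + inj0 w) ∙ (s0 y + inj0 u)
    = s0 (x ∙ y) + inj0 (x ∙> u + w <∙ y + omega c x y).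
Proof.
rewrite linearDl !linearD /= sec_mul_inj inj_mul_sec inj0_mul0 addr0 inj0_omega.
by rewrite [RHS]addrCA subrKC [RHS]addrC addrA.
Qed.

Lemma lact_coord x w m v :
  (s0 x + inj0 w) ∙> (s1 m + inj1 v)
    = s1 (x ∙> m) + inj1 (x ∙> v + w ▷ m + mu c x m).
Proof.
rewrite linearDl !linearD /= sec_lact_inj inj_lact_sec inj_lact0 addr0 inj1_mu.
by rewrite [RHS]addrCA subrKC [RHS]addrC addrA.
Qed.

Lemma ract_coord m v x w :
  (s1 m + inj1 v) <∙ (s0 x + inj0 w)
    = s1 (m <∙ x) + inj1 (m ◁ w + v <∙ x + nu c m x).
Proof.
rewrite linearDl !linearD /= sec_ract_inj inj_ract_sec inj_ract0 addr0 inj1_nu.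
by rewrite [RHS]addrCA subrKC [RHS]addrC addrA.
Qed.

Lemma lmf_coord m v :
  fE (s1 m + inj1 v) = s0 (lmf X m) + inj0 (phi B v + theta c m).
Proof.
by rewrite !linearD lmf_inj1 inj0_theta [RHS]addrCA subrKC addrC.
Qed.

(** The defects inherit bilinearity and compatibility with the Hom-maps from
    the operations and the sections, because i is injective. *)
Lemma section_cocycle_cochain : cochain c.
Proof.
split.
- split.
  + split=> [x|y] a u v; apply: inj0_inj; rewrite /= linearP !inj0_omega.
      by rewrite !linearP /= scalerDr addrACA.
    by rewrite linearPl !linearP linearPl /= scalerDr addrACA.
  + split=> [x|y] a u v; apply: inj1_inj; rewrite /= linearP !inj1_mu.
      by rewrite !linearP /= scalerDr addrACA.
    by rewrite linearPl !linearP linearPl /= scalerDr addrACA.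
  + split=> [x|y] a u v; apply: inj1_inj; rewrite /= linearP !inj1_nu.
      by rewrite !linearP /= scalerDr addrACA.
    by rewrite linearPl !linearP linearPl /= scalerDr addrACA.
  + move=> a u v; apply: inj0_inj; rewrite /= linearP !inj0_theta.
    by rewrite !linearP /= scalerDr addrACA.
- move=> x y; apply: inj0_inj; rewrite inj0_alpha !inj0_omega linearB.
  by rewrite alphaM -!sec0_alpha alphaM.
- move=> x m; apply: inj1_inj; rewrite inj1_beta !inj1_mu linearB.
  by rewrite beta_lact -sec0_alpha -!sec1_beta beta_lact.
- move=> m x; apply: inj1_inj; rewrite inj1_beta !inj1_nu linearB.
  by rewrite beta_ract -sec0_alpha -!sec1_beta beta_ract.
- move=> m; apply: inj0_inj; rewrite inj0_alpha !inj0_theta linearB.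
  by rewrite lmf_alpha -sec0_alpha -sec1_beta lmf_alpha.
Qed.

(** The two equations for theta express that f on the middle term commutes with
    the left and right actions, the other four are the Hom-associativity laws
    there; all are evaluated on the image of the section. *)
Lemma section_cocycle_eqs : cocycle_eqs c.
Proof.
split=> [x m|m x|x y z|]; [| | |split=> [x y m|m x y|x m y]].
- apply: inj0_inj; rewrite linear0 !linearB linearD /=.
  rewrite -lmf_inj1 -sec_mul_inj !inj0_theta inj1_mu inj0_omega.
  rewrite linearB linearBr /= !lmf_lact [X in X - _ - _]addrC addrAC.
  exact: telescope_fork.
- apply: inj0_inj; rewrite linear0 !linearB linearD /=.
  rewrite -lmf_inj1 -inj_mul_sec !inj0_theta inj1_nu inj0_omega.
  rewrite linearB linearBl /= !lmf_ract [X in X - _ - _]addrC.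
  exact: telescope_fork.
- apply: inj0_inj; rewrite linear0 !linearB linearD /=.
  rewrite -sec_mul_inj -inj_mul_sec !inj0_omega !sec0_alpha.
  rewrite linearBl linearB /= !ha_assoc; exact: telescope_fork.
- apply: inj1_inj; rewrite linear0 !linearB linearD /=.
  rewrite -sec_lact_inj -inj_lact_sec !(inj1_mu, inj0_omega) sec0_alpha sec1_beta.
  rewrite linearBl linearB /= !lact_assoc [LHS]addrAC; exact: telescope_fork.
- apply: inj1_inj; rewrite linear0 !linearB linearD /=.
  rewrite -sec_ract_inj -inj_ract_sec !(inj1_nu, inj0_omega) sec0_alpha sec1_beta.
  rewrite linearBl linearB /= !ract_assoc [LHS]addrAC; exact: telescope_fork.
- apply: inj1_inj; rewrite linear0 !linearB linearD /=.
  rewrite -sec_lact_inj -inj_ract_sec !(inj1_mu, inj1_nu) !sec0_alpha.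
  rewrite linearBl linearB /= !lract_assoc; exact: telescope_fork.
Qed.

End Coordinates.

Lemma section_cocycle_uniq c d :
  section_cocycle s0 s1 c -> section_cocycle s0 s1 d -> c = d.
Proof.
case: c d => [[[om m] n] th] [[[om' m'] n'] th'].
move=> [/= c1 c2 c3 c4] [/= d1 d2 d3 d4]; congr (_, _, _, _).
- by apply/funext=> x; apply/funext=> y; apply: inj0_inj; rewrite [LHS]c1 -d1.
- by apply/funext=> x; apply/funext=> y; apply: inj1_inj; rewrite [LHS]c2 -d2.
- by apply/funext=> x; apply/funext=> y; apply: inj1_inj; rewrite [LHS]c3 -d3.
- by apply/funext=> x; apply: inj0_inj; rewrite [LHS]c4 -d4.
Qed.

Lemma section_cocycle_exists : exists c : Z2 B, section_cocycle s0 s1 c.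
Proof.
have [_ k0 _] := ext_exact0 E; have [_ k1 _] := ext_exact1 E.
have /choice[om omE] (a : A * A) :
    exists w, inj0 w = s0 a.1 ∙ s0 a.2 - s0 (a.1 ∙ a.2).
  by apply/k0; rewrite linearB /= mor0_mul !proj0_sec subrr.
have /choice[m mE] (a : A * M) :
    exists v, inj1 v = s0 a.1 ∙> s1 a.2 - s1 (a.1 ∙> a.2).
  by apply/k1; rewrite linearB /= mor1_lact !(proj0_sec, proj1_sec) subrr.
have /choice[n nE] (a : M * A) :
    exists v, inj1 v = s1 a.1 <∙ s0 a.2 - s1 (a.1 <∙ a.2).
  by apply/k1; rewrite linearB /= mor1_ract !(proj0_sec, proj1_sec) subrr.
have /choice[th thE] (a : M) :
    exists w, inj0 w = fE (s1 a) - s0 (lmf X a).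
  by apply/k0; rewrite linearB /= -mor_f !(proj0_sec, proj1_sec) subrr.
pose c : quad B := (fun x y => om (x, y), fun x y => m (x, y),
                    fun x y => n (x, y), th).
have hc : section_cocycle s0 s1 c.
  by split=> *; [exact: omE | exact: mE | exact: nE | exact: thE].
have cZ : c \in @Z2_pred _ _ B.
  apply/asboolP; split; first exact: section_cocycle_cochain hc.
  exact: section_cocycle_eqs hc.
by exists (Cocycle2 cZ).
Qed.

End HomSection.
End ExtensionCoordinates.

(** * Change of section and equivalence of extensions *)

Section Comparison.
Variables (K : fieldType) (X : homLM K) (B : homLM_bimod X).

Local Notation A := (lm0 X).
Local Notation M := (lm1 X).
Local Notation V := (bV B).
Local Notation W := (bW B).

Definition cobord (N0 : A -> W) (N1 : M -> V) : quad B :=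
  (fun x y => N0 x <∙ y + x ∙> N0 y - N0 (x ∙ y),
   fun x m => N0 x ▷ m + x ∙> N1 m - N1 (x ∙> m),
   fun m x => N1 m <∙ x + m ◁ N0 x - N1 (m <∙ x),
   fun m => phi B (N1 m) - N0 (lmf X m)).

Lemma coboundaryE (c : quad B) :
  coboundary c <->
  exists (N0 : {linear A -> W}) (N1 : {linear M -> V}),
    [/\ forall x, N0 (alpha A x) = beta W (N0 x),
        forall m, N1 (beta M m) = beta V (N1 m) & c = cobord N0 N1].
Proof.
split=> -[N0 [N1 [h0 h1 hc]]]; exists N0, N1; last by rewrite hc.
split=> //; case: c hc => [[[om m] n] th] [/= c1 c2 c3 c4].
by congr (_, _, _, _); do ?[apply/funext=> ?];
   [exact: c1 | exact: c2 | exact: c3 | exact: c4].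
Qed.

(** The difference of two sections is killed by p, hence lands in the kernel. *)
Lemma hom_sections_differ (E : abelian_ext B) s0 s1 t0 t1 :
  hom_section (ext_p E) s0 s1 -> hom_section (ext_p E) t0 t1 ->
  exists (N0 : {linear A -> W}) (N1 : {linear M -> V}),
    [/\ forall x, N0 (alpha A x) = beta W (N0 x),
        forall m, N1 (beta M m) = beta V (N1 m),
        forall x, t0 x = s0 x + inj0 E (N0 x)
      & forall m, t1 m = s1 m + inj1 E (N1 m)].
Proof.
move=> hs ht.
have [|N0 N0E] := exact_lift (g := (t0 \- s0)) (ext_exact0 E).
  move=> x /=; rewrite linearB /=.
  by rewrite [X in X - _](proj0_sec ht) [X in _ - X](proj0_sec hs) subrr.
have [|N1 N1E] := exact_lift (g := (t1 \- s1)) (ext_exact1 E).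
  move=> x /=; rewrite linearB /=.
  by rewrite [X in X - _](proj1_sec ht) [X in _ - X](proj1_sec hs) subrr.
exists N0, N1; split=> [x|m|x|m].
- apply: (@inj0_inj _ _ _ E); rewrite inj0_alpha [LHS]N0E [inj0 _ _]N0E /=.
  by rewrite linearB /= (sec0_alpha hs) (sec0_alpha ht).
- apply: (@inj1_inj _ _ _ E); rewrite inj1_beta [LHS]N1E [inj1 _ _]N1E /=.
  by rewrite linearB /= (sec1_beta hs) (sec1_beta ht).
- by rewrite [inj0 _ _]N0E /= subrKC.
- by rewrite [inj1 _ _]N1E /= subrKC.
Qed.

Section Shift.
Variables (E : abelian_ext B).
Variables (s0 t0 : {linear A -> lm0 (ext E)}).
Variables (s1 t1 : {linear M -> lm1 (ext E)}).
Variables (N0 : {linear A -> W}) (N1 : {linear M -> V}).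
Hypothesis t0E : forall x, t0 x = s0 x + inj0 E (N0 x).
Hypothesis t1E : forall m, t1 m = s1 m + inj1 E (N1 m).
Hypothesis hs : hom_section (ext_p E) s0 s1.

Lemma hom_section_shift :
  (forall x, N0 (alpha A x) = beta W (N0 x)) ->
  (forall m, N1 (beta M m) = beta V (N1 m)) ->
  hom_section (ext_p E) t0 t1.
Proof.
move=> h0 h1; split=> [x|m|x|m].
- rewrite t0E linearD /= [X in X + _](proj0_sec hs).
  by rewrite [X in _ + X]proj0_inj0 addr0.
- rewrite t1E linearD /= [X in X + _](proj1_sec hs).
  by rewrite [X in _ + X]proj1_inj1 addr0.
- by rewrite !t0E h0 inj0_alpha (sec0_alpha hs) linearD.
- by rewrite !t1E h1 inj1_beta (sec1_beta hs) linearD.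
Qed.

(** Only the terms linear in (N0, N1) survive, since the quadratic ones are
    products of elements of the abelian kernel. *)
Lemma section_cocycle_shift c :
  section_cocycle s0 s1 c -> section_cocycle t0 t1 (c + cobord N0 N1).
Proof.
move=> hc; split=> [x y|x m|m x|m].
- rewrite !t0E (mul_coord hs hc) opprD addrACA subrr add0r -linearB.
  congr (inj0 E _); rewrite [_ + omega c x y]addrC -addrA.
  by rewrite [_ ∙> _ + _]addrC.
- rewrite t0E !t1E (lact_coord hs hc) opprD addrACA subrr add0r -linearB.
  congr (inj1 E _); rewrite [_ + mu c x m]addrC -addrA.
  by rewrite [_ ∙> _ + _]addrC.
- rewrite t0E !t1E (ract_coord hs hc) opprD addrACA subrr add0r -linearB.
  congr (inj1 E _); rewrite [_ + nu c m x]addrC -addrA.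
  by rewrite [_ ◁ _ + _]addrC.
- rewrite t0E !t1E (lmf_coord hc) opprD addrACA subrr add0r -linearB.
  by congr (inj0 E _); rewrite [_ + theta c m]addrC -addrA.
Qed.

End Shift.

Lemma hom_section_morphism (E E' : abelian_ext B) s0 s1
    (F : homLM_mor (ext E) (ext E')) :
  (forall x, mor0 (ext_p E') (mor0 F x) = mor0 (ext_p E) x) ->
  (forall m, mor1 (ext_p E') (mor1 F m) = mor1 (ext_p E) m) ->
  hom_section (ext_p E) s0 s1 ->
  hom_section (ext_p E') (mor0 F \o s0) (mor1 F \o s1).
Proof.
move=> p0 p1 [h1 h2 h3 h4]; split=> [x|m|x|m] /=; first by rewrite p0.
- by rewrite p1.
- by rewrite h3 mor0_alpha.
- by rewrite h4 mor1_beta.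
Qed.

Lemma section_cocycle_morphism (E E' : abelian_ext B) s0 s1 (c : quad B)
    (F : homLM_mor (ext E) (ext E')) :
  (forall w, mor0 F (mor0 (ext_i E) w) = mor0 (ext_i E') w) ->
  (forall v, mor1 F (mor1 (ext_i E) v) = mor1 (ext_i E') v) ->
  section_cocycle s0 s1 c ->
  section_cocycle (mor0 F \o s0) (mor1 F \o s1) c.
Proof.
move=> i0 i1 [c1 c2 c3 c4]; split=> [x y|x m|m x|m] /=.
- by rewrite -i0 c1 linearB mor0_mul.
- by rewrite -i1 c2 linearB mor1_lact.
- by rewrite -i1 c3 linearB mor1_ract.
- by rewrite -i0 c4 linearB mor_f.
Qed.

(** The map s x + i w |-> t x + i' w is multiplicative and equivariant because
    the structure maps on both sides are given by the same formulas in x, w and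
    the common cocycle c. *)
Lemma ext_equiv_same_cocycle (E E' : abelian_ext B) s0 s1 t0 t1 (c : quad B) :
  hom_section (ext_p E) s0 s1 -> section_cocycle s0 s1 c ->
  hom_section (ext_p E') t0 t1 -> section_cocycle t0 t1 c ->
  ext_equiv E E'.
Proof.
move=> hs hc ht hd.
have [F0 F0E] : exists F : {linear lm0 (ext E) -> lm0 (ext E')},
    forall x w, F (s0 x + inj0 E w) = t0 x + inj0 E' w.
  by apply: split_extend (ext_exact0 E) _ => x; exact: (proj0_sec hs).
have [F1 F1E] : exists F : {linear lm1 (ext E) -> lm1 (ext E')},
    forall m v, F (s1 m + inj1 E v) = t1 m + inj1 E' v.
  by apply: split_extend (ext_exact1 E) _ => x; exact: (proj1_sec hs).
have F0_alpha e : F0 (alpha _ e) = alpha _ (F0 e).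
  have [x [w ->]] := sec0_decomp hs e.
  rewrite F0E !linearD /= -(sec0_alpha hs) -(sec0_alpha ht) -!inj0_alpha.
  by rewrite -linearD F0E.
have F1_beta e : F1 (beta _ e) = beta _ (F1 e).
  have [x [w ->]] := sec1_decomp hs e.
  rewrite F1E !linearD /= -(sec1_beta hs) -(sec1_beta ht) -!inj1_beta.
  by rewrite -linearD F1E.
have F0M e e' : F0 (e ∙ e') = F0 e ∙ F0 e'.
  have [x [w ->]] := sec0_decomp hs e; have [y [u ->]] := sec0_decomp hs e'.
  by rewrite (mul_coord hs hc) !F0E (mul_coord ht hd).
have F_lact e e' : F1 (e ∙> e') = F0 e ∙> F1 e'.
  have [x [w ->]] := sec0_decomp hs e; have [y [u ->]] := sec1_decomp hs e'.
  by rewrite (lact_coord hs hc) F0E !F1E (lact_coord ht hd).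
have F_ract e e' : F1 (e <∙ e') = F1 e <∙ F0 e'.
  have [x [w ->]] := sec1_decomp hs e; have [y [u ->]] := sec0_decomp hs e'.
  by rewrite (ract_coord hs hc) F0E !F1E (ract_coord ht hd).
have F_f e : lmf _ (F1 e) = F0 (lmf _ e).
  have [x [w ->]] := sec1_decomp hs e.
  by rewrite (lmf_coord hc) F0E !F1E (lmf_coord hd).
exists (HomLMMor F0_alpha F1_beta F0M F_lact F_ract F_f); split=> [w|v|e|e] /=.
- by have := F0E 0 w; rewrite !linear0 !add0r.
- by have := F1E 0 v; rewrite !linear0 !add0r.
- have [x [w ->]] := sec0_decomp hs e; rewrite F0E !linearD.
  by congr (_ + _); [rewrite [LHS](proj0_sec ht) [RHS](proj0_sec hs)
                    |rewrite [LHS]proj0_inj0 [RHS]proj0_inj0].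
- have [x [w ->]] := sec1_decomp hs e; rewrite F1E !linearD.
  by congr (_ + _); [rewrite [LHS](proj1_sec ht) [RHS](proj1_sec hs)
                    |rewrite [LHS]proj1_inj1 [RHS]proj1_inj1].
Qed.

Definition represents (E : abelian_ext B) (c : quad B) : Prop :=
  exists s0 s1, hom_section (ext_p E) s0 s1 /\ section_cocycle s0 s1 c.

Lemma represents_exists E : exists c : Z2 B, represents E c.
Proof.
have [s0 [s1 hs]] := ext_split E.
by have [c hc] := section_cocycle_exists hs; exists c, s0, s1.
Qed.

(** Both directions reduce to a comparison inside E': an equivalence transports
    the section of E to E', and a coboundary moves the section of E' to one whose
    cocycle is that of E. *)
Lemma ext_equivP (E E' : abelian_ext B) (c c' : quad B) :
  represents E c -> represents E' c' ->
  ext_equiv E E' <-> coboundary (c - c').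
Proof.
move=> [s0 [s1 [hs hc]]] [t0 [t1 [ht hd]]]; split=> [[F [Fi0 Fi1 Fp0 Fp1]]|].
  have [N0 [N1 [h0 h1 t0E t1E]]] :=
    hom_sections_differ ht (hom_section_morphism Fp0 Fp1 hs).
  apply/coboundaryE; exists N0, N1; split=> //.
  have := section_cocycle_shift t0E t1E ht hd.
  move=> /(section_cocycle_uniq (section_cocycle_morphism Fi0 Fi1 hc)) ->.
  by rewrite addrC addKr.
move=> /coboundaryE[N0 [N1 [h0 h1 cE]]].
pose u0 : {linear A -> lm0 (ext E')} := t0 \+ (inj0 E' \o N0).
pose u1 : {linear M -> lm1 (ext E')} := t1 \+ (inj1 E' \o N1).
have u0E x : u0 x = t0 x + inj0 E' (N0 x) by [].
have u1E m : u1 m = t1 m + inj1 E' (N1 m) by [].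
apply: (ext_equiv_same_cocycle hs hc (hom_section_shift u0E u1E ht h0 h1)).
have -> : c = c' + cobord N0 N1 by rewrite -cE addrC subrK.
exact: (section_cocycle_shift u0E u1E ht hd).
Qed.

End Comparison.

(** * The extension defined by a cocycle *)

Lemma bilin0r (K : fieldType) (U V T : lmodType K) (h : U -> V -> T) u :
  bilin h -> h u 0 = 0.
Proof.
move=> [hl _]; have [g gE] := linear_of_fun (hl u).
by rewrite -gE linear0.
Qed.

Lemma bilin0l (K : fieldType) (U V T : lmodType K) (h : U -> V -> T) v :
  bilin h -> h 0 v = 0.
Proof.
move=> [_ hr]; have [g gE] := linear_of_fun (hr v).
by rewrite -[h 0 v]gE linear0.
Qed.

Section TwistedProduct.
Variables (K : fieldType) (U1 U2 V1 V2 T1 T2 : lmodType K).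
Variables (P : {bilinear U1 -> V1 -> T1}).
Variables (L : {bilinear U1 -> V2 -> T2}) (R : {bilinear U2 -> V1 -> T2}).
Variable h : U1 -> V1 -> T2.
Hypothesis hh : bilin h.

(** The pattern common to the product and the two actions of the extension: a
    semidirect product on direct sums, twisted by the bilinear map h. *)
Definition twisted (a : U1 * U2) (b : V1 * V2) : T1 * T2 :=
  (P a.1 b.1, L a.1 b.2 + R a.2 b.1 + h a.1 b.1).

Lemma twisted_bilinear : bilinear_for *:%R *:%R twisted.
Proof.
have [hr hl] := hh.
split=> u a v w; congr (_, _) => /=.
- by rewrite linearPl.
- rewrite !(linearP, linearPl) [h _ u.1]hl /= !scalerDr.
  by rewrite [X in X + _]addrACA [LHS]addrACA.
- by rewrite linearP.
- rewrite !(linearP, linearPl) hr /= !scalerDr.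
  by rewrite [X in X + _]addrACA [LHS]addrACA.
Qed.

Definition twisted_bilin :
    {bilinear (U1 * U2)%type -> (V1 * V2)%type -> (T1 * T2)%type} :=
  HB.pack twisted
    (bilinear_isBilinear.Build K _ _ _ *:%R *:%R twisted twisted_bilinear).

End TwistedProduct.

Section PairLinear.
Variables (K : fieldType) (U1 U2 V1 V2 : lmodType K).

Definition prod_map (g : {linear U1 -> V1}) (h : {linear U2 -> V2})
  (a : U1 * U2) : V1 * V2 := (g a.1, h a.2).

Lemma prod_map_linear g h : linear (prod_map g h).
Proof. by move=> a u v; rewrite /prod_map /= !linearP. Qed.

Definition prod_lin (g : {linear U1 -> V1}) (h : {linear U2 -> V2}) :
    {linear (U1 * U2)%type -> (V1 * V2)%type} :=
  HB.pack (prod_map g h)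
    (GRing.isLinear.Build K _ _ *:%R _ (prod_map_linear g h)).

Lemma inl_linear : linear (fun x : U1 => (x, 0 : U2)).
Proof. by move=> a u v; congr (_, _); rewrite /= scaler0 addr0. Qed.
Lemma inr_linear : linear (fun x : U2 => (0 : U1, x)).
Proof. by move=> a u v; congr (_, _); rewrite /= scaler0 addr0. Qed.

Definition inl_lin : {linear U1 -> (U1 * U2)%type} :=
  HB.pack (fun x : U1 => (x, 0 : U2))
    (GRing.isLinear.Build K _ _ *:%R _ inl_linear).
Definition inr_lin : {linear U2 -> (U1 * U2)%type} :=
  HB.pack (fun x : U2 => (0 : U1, x))
    (GRing.isLinear.Build K _ _ *:%R _ inr_linear).

Lemma fst_exact : exact_seq inr_lin (fst : U1 * U2 -> U1).
Proof.
split=> [u v [] //|[x u] /=|x]; last by exists (x, 0).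
by split=> [->|[v []]]; first by exists u.
Qed.

End PairLinear.

(** The kernel component of each Hom-associativity law on the twisted direct
    sum: a, b, d are the terms matched by the bimodule axioms, and p, q, r, t
    are the four terms of the cocycle equation. *)
Lemma twisted_assoc_sum (U : zmodType) (a b d p q r t : U) :
  p + q - t - r = 0 -> a + b + p + d + q = a + (b + d + r) + t.
Proof.
move=> /eqP; rewrite subr_eq0 subr_eq => /eqP pq.
rewrite addrAC -(addrA (a + b)) pq -!addrA; congr (_ + (_ + _)).
by rewrite [RHS]addrC -addrA.
Qed.

Section TwistedExtension.
Variables (K : fieldType) (X : homLM K) (B : homLM_bimod X).

Local Notation A := (lm0 X).
Local Notation M := (lm1 X).
Local Notation V := (bV B).
Local Notation W := (bW B).
Local Notation f := (lmf X).

Variable c : Z2 B.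

Lemma twisting_cocycle : cochain c /\ cocycle_eqs c.
Proof. exact/asboolP/(z2valP c). Qed.

Lemma omega_bilin : bilin (omega c).
Proof. by case: twisting_cocycle => -[[]]. Qed.
Lemma mu_bilin : bilin (mu c).
Proof. by case: twisting_cocycle => -[[]]. Qed.
Lemma nu_bilin : bilin (nu c).
Proof. by case: twisting_cocycle => -[[]]. Qed.
Lemma theta_linear : linear (theta c).
Proof. by case: twisting_cocycle => -[[]]. Qed.

Definition tw_mul : {bilinear (A * W)%type -> (A * W)%type -> (A * W)%type} :=
  twisted_bilin (ha_mul A) (lact W) (ract W) omega_bilin.
Definition tw_lact : {bilinear (A * W)%type -> (M * V)%type -> (M * V)%type} :=
  twisted_bilin (lact M) (lact V) (rtri B) mu_bilin.
Definition tw_ract : {bilinear (M * V)%type -> (A * W)%type -> (M * V)%type} :=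
  twisted_bilin (ract M) (ltri B) (ract V) nu_bilin.
Definition tw_alpha := prod_lin (alpha A) (beta W).
Definition tw_beta := prod_lin (beta M) (beta V).
Definition tw_f_fun (n : M * V) : A * W := (f n.1, phi B n.2 + theta c n.1).

Lemma tw_f_linear : linear tw_f_fun.
Proof.
move=> a u v; congr (_, _) => /=; first by rewrite linearP.
by rewrite linearP theta_linear /= scalerDr addrACA.
Qed.

Definition tw_f : {linear (M * V)%type -> (A * W)%type} :=
  HB.pack tw_f_fun (GRing.isLinear.Build K _ _ *:%R _ tw_f_linear).

Lemma tw_assoc (x y z : A * W) :
  tw_mul (tw_alpha x) (tw_mul y z) = tw_mul (tw_mul x y) (tw_alpha z).
Proof.
congr (_, _) => /=; first by rewrite ha_assoc.
have [_ [_ _ e _]] := twisting_cocycle; have {}e := e x.1 y.1 z.1.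
rewrite !linearD !linearDl /= lact_assoc lract_assoc -ract_assoc.
by apply: twisted_assoc_sum; rewrite -e.
Qed.

Lemma tw_alphaM (x y : A * W) :
  tw_alpha (tw_mul x y) = tw_mul (tw_alpha x) (tw_alpha y).
Proof.
have [[_ e _ _ _] _] := twisting_cocycle.
congr (_, _) => /=; first by rewrite alphaM.
by rewrite !linearD /= beta_lact beta_ract e.
Qed.

Definition tw_alg : homAssoc K := HomAssoc tw_assoc tw_alphaM.

(** Left associativity uses the cocycle equation for mu, right associativity the
    one for nu, and mixed associativity the one that links mu and nu. *)
Definition tw_mod : homBimod tw_alg.
Proof.
refine (@HomBimod K tw_alg (M * V)%type tw_lact tw_ract tw_beta _ _ _ _ _).
all: have [[_ _ emu enu _] [_ _ _ [e4 e5 e6]]] := twisting_cocycle.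
- move=> x m; congr (_, _) => /=; first by rewrite beta_lact.
  by rewrite !linearD /= beta_lact rtri_beta emu.
- move=> m x; congr (_, _) => /=; first by rewrite beta_ract.
  by rewrite !linearD /= beta_ract ltri_beta enu.
- move=> x y m; congr (_, _) => /=; first by rewrite lact_assoc.
  rewrite !linearD !linearDl /= lact_assoc lact_rtri -rtri_lact.
  by apply: twisted_assoc_sum; rewrite -(e4 x.1 y.1 m.1) addrAC.
- move=> m x y; congr (_, _) => /=; first by rewrite ract_assoc.
  rewrite !linearD !linearDl /= ltri_ract -ract_ltri -ract_assoc.
  by apply: twisted_assoc_sum; rewrite -(e5 m.1 x.1 y.1) addrAC.
- move=> x m y; congr (_, _) => /=; first by rewrite lract_assoc.
  rewrite !linearD !linearDl /= lract_assoc lact_ltri -rtri_ract.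
  by apply: twisted_assoc_sum; rewrite -(e6 x.1 m.1 y.1).
Defined.

(** The map (m, v) |-> (f m, phi v + theta m) is equivariant because the two
    cocycle equations for theta compensate the twists mu, nu by omega. *)
Definition tw_LM : homLM K.
Proof.
refine (@HomLM K tw_alg tw_mod tw_f _ _ _).
all: have [[_ _ _ _ eth] [e1 e2 _ _]] := twisting_cocycle.
- move=> m; congr (_, _) => /=; first by rewrite lmf_alpha.
  by rewrite !linearD /= phi_beta eth.
- move=> x m; congr (_, _) => /=; first by rewrite lmf_lact.
  rewrite !linearD /= phi_lact phi_rtri -!addrA; congr (_ + _).
  rewrite [RHS]addrCA; congr (_ + _); apply/eqP.
  by rewrite -subr_eq0 opprD !addrA -(e1 x.1 m.1) [phi B _ + _]addrC.
- move=> m x; congr (_, _) => /=; first by rewrite lmf_ract.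
  rewrite !linearD linearDl /= phi_ract phi_ltri.
  rewrite addrAC -addrA [in RHS]addrA -[RHS]addrA.
  congr (_ + _); apply/eqP.
  by rewrite -subr_eq0 opprD addrA addrAC -(e2 m.1 x.1).
Defined.

Definition tw_i : homLM_mor (abelian_LM B) tw_LM.
Proof.
refine (@HomLMMor K (abelian_LM B) tw_LM (inr_lin A W) (inr_lin M V)
  _ _ _ _ _ _).
- by move=> w; congr (_, _); rewrite /= linear0.
- by move=> v; congr (_, _); rewrite /= linear0.
- move=> w u; congr (_, _); rewrite /= linear0l //.
  by rewrite linear0 !add0r (bilin0r _ omega_bilin).
- move=> w u; congr (_, _); rewrite /= linear0l //.
  by rewrite linear0 !add0r (bilin0r _ mu_bilin).
- move=> w u; congr (_, _); rewrite /= linear0l //.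
  by rewrite linear0 !add0r (bilin0r _ nu_bilin).
- move=> v; congr (_, _) => /=; first by rewrite linear0.
  have [g gE] := linear_of_fun theta_linear.
  by rewrite -gE linear0 addr0.
Defined.

Definition tw_p : homLM_mor tw_LM X.
Proof.
by refine (@HomLMMor K tw_LM X (fst : {linear (A * W)%type -> A})
  (fst : {linear (M * V)%type -> M}) _ _ _ _ _ _).
Defined.

Lemma tw_hom_section :
  hom_section tw_p (inl_lin A W) (inl_lin M V).
Proof.
by split=> // [x|m]; congr (_, _); rewrite /= linear0.
Qed.

Definition tw_ext : abelian_ext B.
Proof.
refine (@AbelianExt K X B tw_LM tw_i tw_p (fst_exact A W) (fst_exact M V)
  (ex_intro _ _ (ex_intro _ _ tw_hom_section)) _ _ _ _ _ _).
all: move=> x h v <-; congr (_, _); rewrite /= ?(linear0, linear0l) //.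
all: rewrite ?add0r ?addr0.
- by rewrite (bilin0r _ mu_bilin) addr0.
- by rewrite (bilin0l _ nu_bilin) addr0.
- by rewrite (bilin0r _ omega_bilin) addr0.
- by rewrite (bilin0l _ omega_bilin) addr0.
- by rewrite (bilin0l _ mu_bilin) addr0.
- by rewrite (bilin0r _ nu_bilin) addr0.
Defined.

(** The section x |-> (x, 0) recovers the cocycle used for the twist. *)
Lemma tw_represents : represents tw_ext c.
Proof.
exists (inl_lin A W), (inl_lin M V); split; first exact: tw_hom_section.
by split=> [x y|x m|m x|m]; congr (_, _);
   rewrite /= ?subrr ?subr0 ?(linear0, linear0l) ?add0r.
Qed.

End TwistedExtension.

(** * The classification *)

Lemma H2_class_eq (K : fieldType) (X : homLM K) (B : homLM_bimod X)
    (c c' : Z2 B) :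
  H2_class c = H2_class c' <-> coboundary (c - c' : Z2 B).
Proof.
rewrite /H2_class; split.
  by move=> /eqP; rewrite -Quotient.idealrBE; move=> /asboolP.
by move=> h; apply/eqP; rewrite -Quotient.idealrBE; apply/asboolP.
Qed.

Theorem theorem5p11 (K : fieldType) (charK : [pchar K] =i pred0)
    (X : homLM K) (B : homLM_bimod X) :
  exists Phi : abelian_ext B -> H2 B,
    [/\ forall E E' : abelian_ext B, ext_equiv E E' <-> Phi E = Phi E',
        forall h : H2 B, exists E : abelian_ext B, Phi E = h
      & forall (E : abelian_ext B)
          (s0 : {linear lm0 X -> lm0 (ext E)})
          (s1 : {linear lm1 X -> lm1 (ext E)}) (c : Z2 B),
          hom_section (ext_p E) s0 s1 -> section_cocycle s0 s1 c ->
          Phi E = H2_class c].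
Proof.
have [cc ccE] := choice (@represents_exists K X B).
have equivP E E' (c c' : Z2 B) : represents E c -> represents E' c' ->
    ext_equiv E E' <-> H2_class c = H2_class c'.
  by move=> hc hc'; rewrite H2_class_eq z2valB; exact: ext_equivP.
have equiv_refl (E : abelian_ext B) : ext_equiv E E.
  exact: (equivP E E _ _ (ccE E) (ccE E)).2 erefl.
exists (fun E => H2_class (cc E)); split=> [E E'|h|E s0 s1 c hs hc].
- exact: equivP.
- have [c <-] : exists c : Z2 B, H2_class c = h.
    by exists (repr (h : Quotient.quot (@B2_pred K X B))); exact: reprK.
  exists (tw_ext c).
  exact: (equivP _ _ _ _ (ccE _) (tw_represents c)).1 (equiv_refl _).
- have hE : represents E c by exists s0, s1.
  exact: (equivP E E _ _ (ccE E) hE).1 (equiv_refl E).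
Qed.
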